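(* Let $n,d,M\ge 1$ be integers and let $\epsilon>0$, $\tilde L>0$, $0<\beta\le \mathcal{B}$ be real parameters. For each node $i\in\{1,\dots,n\}$ let $\{x_i^k\}_{k\ge 0}$ and $\{g_i^k\}_{k\ge 0}$ be sequences in $\mathbb{R}^d$, and let the matrices $H_i^{k}$, $k\ge 1$, be constructed by the damped limited-memory BFGS method with memory size $M$ (as defined in the context). Then $$M_1 I_d\preceq H_i^{k}\preceq M_2 I_d,\qquad \forall\, i=1,\dots,n,\ \forall\, k\ge 1,$$ where $$M_1=\left(\frac1\beta+\frac{M\omega^2}{4(\mathcal{B}+\epsilon)}\right)^{-1},\qquad M_2=(1+\omega)^{2M}\left(\mathcal{B}+\frac{1}{\tilde L(\omega+2)}\right),\qquad \omega=4(\mathcal{B}+\epsilon)\left(\tilde L+\frac{1}{\beta+\epsilon}\right).$$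
   Context: Notation: $\|\cdot\|$ is the Euclidean norm, $I_d$ the $d\times d$ identity, and $A\succeq B$ means $A-B$ is positive semidefinite. In the application, $x_i^k$ is the local decision variable and $g_i^k$ the local gradient approximation of node $i$ at time $k$; the construction below uses only these two sequences. Damped limited-memory BFGS at node $i$. For every $k\ge 0$ put $$s_i^k=x_i^{k+1}-x_i^k,\qquad y_i^k=g_i^{k+1}-g_i^k .$$ It is assumed that all quotients below are well defined, i.e. $s_i^k\neq 0$ and $y_i^k\neq0$ for all $k$. Fix a time $k\ge 0$. Set $\tilde M=\min\{k+1,M\}$ and the initialization $$H_i^{k,(0)}=\min\left\{\max\left\{\frac{(s_i^k)^Ty_i^k}{(y_i^k)^Ty_i^k},\ \beta\right\},\ \mathcal{B}\right\}I_d,$$ so that $\beta I_d\preceq H_i^{k,(0)}\preceq \mathcal{B}I_d$. For each $p\in\{k+1-\tilde M,\dots,k\}$ write $a_i^p=(s_i^p)^T(H_i^{k,(0)}+\epsilon I_d)^{-1}s_i^p$ and define $$\tilde\theta_i^p=\begin{cases}\dfrac{0.75\,a_i^p}{a_i^p-(s_i^p)^Ty_i^p}, & \text{if } (s_i^p)^Ty_i^p\le 0.25\,a_i^p,\\[2mm] 1,&\text{otherwise,}\end{cases}\qquad \theta_i^p=\min\left\{\tilde\theta_i^p,\ \frac{\tilde L\|s_i^p\|}{\|y_i^p\|}\right\},$$ $$\hat y_i^p=\theta_i^p y_i^p+(1-\theta_i^p)(H_i^{k,(0)}+\epsilon I_d)^{-1}s_i^p .$$ For $t=0,\dots,\tilde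 M-1$, with $p=k+1-\tilde M+t$, set $$H_i^{k,(t+1)}=\left(I_d-\frac{s_i^p(\hat y_i^p)^T}{(s_i^p)^T\hat y_i^p}\right)H_i^{k,(t)}\left(I_d-\frac{\hat y_i^p(s_i^p)^T}{(s_i^p)^T\hat y_i^p}\right)+\frac{s_i^p(s_i^p)^T}{(s_i^p)^T\hat y_i^p}.$$ Finally $H_i^{k+1}=H_i^{k,(\tilde M)}$. *)

(* Defs.v *)
From mathcomp Require Import all_boot all_order all_algebra.
From mathcomp Require Import reals.

Set Implicit Arguments.
Unset Strict Implicit.
Unset Printing Implicit Defensive.

Import Order.TTheory GRing.Theory Num.Theory.

Local Open Scope ring_scope.

Definition dotv (R : realType) (d : nat) (u v : 'cV[R]_d) : R :=
  (u^T *m v) 0 0.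

(* The norm `|_| of the library on matrices is the sup norm. *)
Definition enorm (R : realType) (d : nat) (u : 'cV[R]_d) : R :=
  Num.sqrt (dotv u u).

(* Positive semidefiniteness includes symmetry. *)
Definition psdmx (R : realType) (d : nat) (A : 'M[R]_d) : Prop :=
  A^T = A /\ forall v : 'cV[R]_d, 0 <= dotv v (A *m v).

Definition loewner_le (R : realType) (d : nat) (A B : 'M[R]_d) : Prop :=
  psdmx (B - A).

Definition incr (R : realType) (d : nat) (u : nat -> 'cV[R]_d) (k : nat) :
  'cV[R]_d := u k.+1 - u k.

Definition init_mx (R : realType) (d : nat) (beta B : R) (s y : 'cV[R]_d) :
  'M[R]_d :=
  (Num.min (Num.max (dotv s y / dotv y y) beta) B)%:M.

(* The matrix P stands for H^(0) + eps I. *)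
Definition damp_tilde (R : realType) (d : nat) (P : 'M[R]_d)
    (s y : 'cV[R]_d) : R :=
  let a := dotv s (invmx P *m s) in
  if dotv s y <= 1 / 4 * a then (3 / 4 * a) / (a - dotv s y) else 1.

Definition damp (R : realType) (d : nat) (Lt : R) (P : 'M[R]_d)
    (s y : 'cV[R]_d) : R :=
  Num.min (damp_tilde P s y) (Lt * enorm s / enorm y).

Definition damped_y (R : realType) (d : nat) (Lt : R) (P : 'M[R]_d)
    (s y : 'cV[R]_d) : 'cV[R]_d :=
  let theta := damp Lt P s y in
  theta *: y + (1 - theta) *: (invmx P *m s).

Definition bfgs_update (R : realType) (d : nat) (H : 'M[R]_d)
    (s y : 'cV[R]_d) : 'M[R]_d :=
  let r := dotv s y in
  (1%:M - r^-1 *: (s *m y^T)) *m H *m (1%:M - r^-1 *: (y *m s^T))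
  + r^-1 *: (s *m s^T).

(* The matrix H^{k,(t)} of one node, for 0 <= t <= min(k + 1, M). The
   initialization uses the pair of index k, also when damping the pairs of
   earlier indices p. *)
Fixpoint dlbfgs_iter (R : realType) (d M : nat) (eps Lt beta B : R)
    (x g : nat -> 'cV[R]_d) (k t : nat) {struct t} : 'M[R]_d :=
  let H0 := init_mx beta B (incr x k) (incr g k) in
  if t is t'.+1 then
    let p := (k.+1 - minn k.+1 M + t')%N in
    bfgs_update (dlbfgs_iter M eps Lt beta B x g k t') (incr x p)
      (damped_y Lt (H0 + eps%:M) (incr x p) (incr g p))
  else H0.

(* The matrix H^{k+1}, built at time k. *)
Definition dlbfgs_next (R : realType) (d M : nat) (eps Lt beta B : R)
    (x g : nat -> 'cV[R]_d) (k : nat) : 'M[R]_d :=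
  dlbfgs_iter M eps Lt beta B x g k (minn k.+1 M).

(* Main.v *)
Require Import Defs.
From mathcomp Require Import all_boot all_order all_algebra.
From mathcomp Require Import reals.
From mathcomp Require Import ring lra.

(** Every damped pair (s, y) satisfies a curvature bound
    dotv s s <= 4 (B + eps) dotv s y ([damped_y_curvature]) and a length bound
    |y| <= (Lt + 1 / (beta + eps)) |s| ([enorm_damped_y]).  The first comes from
    the choice of the damping factor, which keeps at least a quarter of the
    curvature dotv s (P^-1 s) of the reference pair; the second comes from the
    cap Lt |s| / |y| on that factor.  Together they give
      |s| |y| <= omega dotv s y   and
      |y|^2 <= omega^2 / (4 (B + eps)) dotv s y.

    With tau = dotv s v / dotv s y and w = v - tau y, the quadratic form of the
    updated matrix at v is that of H at w plus tau^2 dotv s y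
    ([bfgs_update_quad]).  Both spectral bounds are read off this formula.

    Upper bound ([bfgs_update_upper]): |w| <= (1 + omega) |v|, and the
    additional term is at most 4 (B + eps) |v|^2.  So an upper bound h becomes
    (1 + omega)^2 h + 4 (B + eps).  The shift D = 1 / (Lt (omega + 2))
    satisfies 4 (B + eps) <= ((1 + omega)^2 - 1) D, hence h + D grows at most
    by the factor (1 + omega)^2 per update.

    Lower bound ([bfgs_update_lower]): the classical argument bounds the
    largest eigenvalue of H^-1, to which an update adds at most
    |y|^2 / dotv s y.  The same estimate is obtained without inverses by
    applying the Cauchy-Schwarz inequality to v = w + tau y: the reciprocal of
    a lower bound increases by at most omega^2 / (4 (B + eps)).

    Iterating at most M times from beta I <= H^(0) <= B I gives M1 and M2. *)

Set Implicit Arguments.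
Unset Strict Implicit.
Unset Printing Implicit Defensive.

Import Order.TTheory GRing.Theory Num.Theory.

Local Open Scope ring_scope.

(** * Euclidean geometry of column vectors *)

Section Euclidean.

Variables (R : realType) (d : nat).
Implicit Types (u v w : 'cV[R]_d) (A : 'M[R]_d) (a : R).

Lemma dotvC u v : dotv u v = dotv v u.
Proof.
by rewrite /dotv !mxE; apply: eq_bigr => i _; rewrite !mxE mulrC.
Qed.

Lemma dotvDr u v w : dotv u (v + w) = dotv u v + dotv u w.
Proof. by rewrite /dotv mulmxDr mxE. Qed.

Lemma dotvZr a u v : dotv u (a *: v) = a * dotv u v.
Proof. by rewrite /dotv -scalemxAr mxE. Qed.

Lemma dotvDl u v w : dotv (u + v) w = dotv u w + dotv v w.
Proof. by rewrite !(dotvC _ w) dotvDr. Qed.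

Lemma dotvZl a u v : dotv (a *: u) v = a * dotv u v.
Proof. by rewrite !(dotvC _ v) dotvZr. Qed.

Lemma dotv_trmx A u v : dotv (A^T *m u) v = dotv u (A *m v).
Proof. by rewrite /dotv trmx_mul trmxK mulmxA. Qed.

Lemma outer_mulmx u v w : (u *m v^T) *m w = dotv v w *: u.
Proof.
by rewrite -mulmxA [v^T *m w]mx11_scalar mul_mx_scalar.
Qed.

Lemma dotv_ge0 u : 0 <= dotv u u.
Proof.
by rewrite /dotv mxE; apply: sumr_ge0 => i _; rewrite mxE -expr2 sqr_ge0.
Qed.

Lemma dotv_gt0 u : u != 0 -> 0 < dotv u u.
Proof.
move=> u0; rewrite lt0r dotv_ge0 andbT; apply: contra u0 => /eqP uu0.
apply/eqP/matrixP => i j; rewrite ord1 mxE; apply/eqP.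
move: uu0; rewrite /dotv mxE => /eqP.
rewrite psumr_eq0 => [/allP/(_ i)|k _]; last by rewrite mxE -expr2 sqr_ge0.
by rewrite mem_index_enum mxE -expr2 sqrf_eq0 => /(_ isT).
Qed.

Lemma sqr_enorm u : enorm u ^+ 2 = dotv u u.
Proof. exact/sqr_sqrtr/dotv_ge0. Qed.

Lemma enorm_ge0 u : 0 <= enorm u.
Proof. exact: sqrtr_ge0. Qed.

Lemma enorm_gt0 u : u != 0 -> 0 < enorm u.
Proof. by move=> u0; rewrite sqrtr_gt0 dotv_gt0. Qed.

Lemma enormZ a u : enorm (a *: u) = `|a| * enorm u.
Proof.
by rewrite /enorm dotvZl dotvZr mulrA -expr2 sqrtrM ?sqr_ge0// sqrtr_sqr.
Qed.

(** Cauchy-Schwarz: the square of the length of |v|^2 u - (u . v) v is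
    nonnegative. *)
Lemma dotv_sqr_le u v : dotv u v ^+ 2 <= dotv u u * dotv v v.
Proof.
have [->|v0] := eqVneq v 0.
  by rewrite -(scale0r u) dotvZr mul0r expr0n mulr_ge0 ?dotv_ge0.
have := dotv_ge0 (dotv v v *: u + (- dotv u v) *: v).
rewrite !(dotvDl, dotvDr, dotvZl, dotvZr) (dotvC v u).
have vv := dotv_gt0 v0.
set p := dotv u u; set q := dotv v v in vv *; set r := dotv u v.
rewrite (_ : _ + _ = q * (p * q - r ^+ 2)); last by ring.
by rewrite pmulr_rge0// subr_ge0.
Qed.

Lemma normr_dotv_le u v : `|dotv u v| <= enorm u * enorm v.
Proof.
rewrite -(ler_pXn2r (n := 2)) ?nnegrE ?mulr_ge0 ?enorm_ge0//.
by rewrite real_normK ?num_real// exprMn !sqr_enorm dotv_sqr_le.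
Qed.

Lemma enormD u v : enorm (u + v) <= enorm u + enorm v.
Proof.
rewrite -(ler_pXn2r (n := 2)) ?nnegrE ?addr_ge0 ?enorm_ge0//.
rewrite sqr_enorm !(dotvDl, dotvDr) (dotvC v u) sqrrD !sqr_enorm.
have := normr_dotv_le u v; have := ler_norm (dotv u v); lra.
Qed.

Lemma loewner_scalar_lower a A : A^T = A ->
  (forall v, a * dotv v v <= dotv v (A *m v)) -> loewner_le a%:M A.
Proof.
move=> As Ale; split; first by rewrite linearB /= tr_scalar_mx As.
move=> v; rewrite mulmxBl mul_scalar_mx -scaleNr dotvDr dotvZr mulNr.
by rewrite subr_ge0.
Qed.

Lemma loewner_scalar_upper a A : A^T = A ->
  (forall v, dotv v (A *m v) <= a * dotv v v) -> loewner_le A a%:M.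
Proof.
move=> As Ale; split; first by rewrite linearB /= tr_scalar_mx As.
move=> v; rewrite mulmxBl mul_scalar_mx -[- (A *m v)]scaleN1r dotvDr !dotvZr.
by rewrite mulN1r subr_ge0.
Qed.

End Euclidean.

(** * Spectral bounds for one update *)

Section Update.

Variables (R : realType) (d : nat) (H : 'M[R]_d) (s y : 'cV[R]_d).
Hypothesis sy_gt0 : 0 < dotv s y.

Let r := dotv s y.

Lemma tr_bfgs_update : H^T = H -> (bfgs_update H s y)^T = bfgs_update H s y.
Proof.
move=> Hs; rewrite /bfgs_update; set U := 1%:M - _; set V := 1%:M - _.
have UV : U^T = V by rewrite /U linearB /= linearZ /= trmx_mul trmxK trmx1.
rewrite [LHS]linearD /= [in X in _ + X]linearZ /= !trmx_mul trmxK Hs -UV.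
by rewrite trmxK mulmxA.
Qed.

(** The vector w is the image of v under the right factor I - y s^T / r. *)
Lemma bfgs_update_quad v (tau := dotv s v / r) (w := v - tau *: y) :
  dotv v (bfgs_update H s y *m v) = dotv w (H *m w) + tau ^+ 2 * r.
Proof.
set Q := 1%:M - r^-1 *: (y *m s^T).
have Ew : Q *m v = w.
  by rewrite mulmxBl mul1mx -scalemxAl outer_mulmx scalerA mulrC.
have EQ : 1%:M - r^-1 *: (s *m y^T) = Q^T.
  by rewrite /Q [RHS]linearB /= [in RHS]linearZ /= trmx_mul trmxK trmx1.
rewrite /bfgs_update -/r EQ mulmxDl dotvDr -!mulmxA Ew -dotv_trmx trmxK Ew.
rewrite -scalemxAl outer_mulmx !dotvZr (dotvC v s) /tau.
by congr (_ + _); field; rewrite gt_eqF.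
Qed.

(** With v = w + tau y, what is needed is the weighted Cauchy-Schwarz inequality
    |w + tau y|^2 <= (1/m + C) (m |w|^2 + tau^2 r).  Since |y|^2 <= C r, it
    follows from the nonnegativity of |C m w - tau y|^2. *)
Lemma bfgs_update_lower (m C : R) : 0 < m -> 0 < C -> dotv y y <= C * r ->
  (forall v, m * dotv v v <= dotv v (H *m v)) ->
  forall v, (m^-1 + C)^-1 * dotv v v <= dotv v (bfgs_update H s y *m v).
Proof.
move=> m0 C0 yC mH v; rewrite bfgs_update_quad.
set tau := _ / r; set w := v - _.
have -> : v = w + tau *: y by rewrite /w subrK.
clearbody w tau.
have A0 : 0 < m^-1 + C by rewrite addr_gt0 ?invr_gt0.
rewrite mulrC ler_pdivrMr//.
apply: (@le_trans _ _ ((m * dotv w w + tau ^+ 2 * r) * (m^-1 + C))); last first.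
  by rewrite ler_pM2r// lerD2r.
have := dotv_ge0 ((C * m) *: w + (- tau) *: y).
rewrite !(dotvDl, dotvDr, dotvZl, dotvZr) (dotvC y w).
have tyC : tau ^+ 2 * dotv y y <= tau ^+ 2 * (C * r).
  by rewrite ler_wpM2l ?sqr_ge0.
set ww := dotv w w; set wy := dotv w y; set yy := dotv y y in tyC *.
move=> sq.
(* The square of C m w - tau y, divided by C m, bounds the cross term. *)
have cross : 2 * tau * wy <= C * m * ww + tau ^+ 2 * r / m.
  rewrite -(ler_pM2l (mulr_gt0 C0 m0)).
  have -> : C * m * (C * m * ww + tau ^+ 2 * r / m) =
            (C * m) ^+ 2 * ww + tau ^+ 2 * (C * r).
    by field; rewrite gt_eqF.
  by move: sq tyC; lra.
have -> : (m * ww + tau ^+ 2 * r) * (m^-1 + C) =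
  ww + (C * m * ww + tau ^+ 2 * r / m) + tau ^+ 2 * (C * r).
  by field; rewrite gt_eqF.
by move: cross tyC; lra.
Qed.

(** In operator terms, |I - y s^T / r| <= 1 + |s| |y| / r <= 1 + omega and
    |s s^T / r| <= |s|^2 / r <= K. *)
Lemma bfgs_update_upper (h K omega : R) : 0 <= h -> dotv s s <= K * r ->
  enorm s * enorm y <= omega * r ->
  (forall v, dotv v (H *m v) <= h * dotv v v) ->
  forall v, dotv v (bfgs_update H s y *m v)
              <= ((1 + omega) ^+ 2 * h + K) * dotv v v.
Proof.
move=> h0 sK syO Hh v; rewrite bfgs_update_quad.
set tau := _ / r; set w := v - _.
have r0 : 0 < r := sy_gt0.
have O0 : 0 <= omega.
  by rewrite -(pmulr_lge0 _ r0) (le_trans _ syO)// mulr_ge0 ?enorm_ge0.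
have wv : enorm w <= (1 + omega) * enorm v.
  rewrite /w -scaleNr (le_trans (enormD _ _))// enormZ normrN mulrDl mul1r lerD2l.
  rewrite /tau normrM normfV (gtr0_norm r0) mulrAC ler_pdivrMr//.
  apply: (@le_trans _ _ (enorm s * enorm v * enorm y)).
    by rewrite ler_wpM2r ?enorm_ge0// normr_dotv_le.
  by rewrite mulrAC [leRHS]mulrAC ler_wpM2r ?enorm_ge0.
have ww : dotv w w <= (1 + omega) ^+ 2 * dotv v v.
  by rewrite -!sqr_enorm -exprMn ler_pXn2r ?nnegrE ?mulr_ge0 ?addr_ge0 ?enorm_ge0.
have tK : tau ^+ 2 * r <= K * dotv v v.
  have -> : tau ^+ 2 * r = dotv s v ^+ 2 / r.
    by rewrite /tau; field; rewrite gt_eqF.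
  rewrite ler_pdivrMr// (le_trans (dotv_sqr_le s v))// mulrAC.
  by rewrite ler_wpM2r ?dotv_ge0.
rewrite mulrDl lerD// (le_trans (Hh w))//.
by rewrite [leRHS]mulrAC [leRHS]mulrC ler_wpM2l.
Qed.

End Update.

(** * Damped gradient differences *)

Section Damping.

Variables (R : realType) (d : nat) (Lt c : R) (s y : 'cV[R]_d).
Hypotheses (Lt_gt0 : 0 < Lt) (c_gt0 : 0 < c).
Hypotheses (s_neq0 : s != 0) (y_neq0 : y != 0).

Let P : 'M[R]_d := c%:M.
Let theta := damp Lt P s y.
Let a := dotv s s / c.

Lemma invmx_scalar_mul : invmx P *m s = c^-1 *: s.
Proof. by rewrite /P invmx_scalar mul_scalar_mx. Qed.

Lemma dotv_invmx_scalar : dotv s (invmx P *m s) = a.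
Proof. by rewrite invmx_scalar_mul dotvZr mulrC. Qed.

Let a_gt0 : 0 < a.
Proof. by rewrite divr_gt0 ?dotv_gt0. Qed.

Lemma damp_tilde_itv : 0 <= damp_tilde P s y <= 1.
Proof.
rewrite /damp_tilde dotv_invmx_scalar.
case: ifPn => [sya|_]; last by rewrite ler01 lexx.
have a0 := a_gt0.
(* Here a - s . y >= 3/4 a > 0. *)
have D0 : 0 < a - dotv s y by lra.
by rewrite divr_ge0 ?ler_pdivrMr//=; lra.
Qed.

Lemma damp_ge0 : 0 <= theta.
Proof.
rewrite /theta /damp le_min; have /andP[-> _] := damp_tilde_itv.
by rewrite /= divr_ge0 ?mulr_ge0 ?enorm_ge0// ltW.
Qed.

Lemma damp_le1 : theta <= 1.
Proof.
by have /andP[_] := damp_tilde_itv; apply: le_trans; rewrite ge_min lexx.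
Qed.

(** If s . y <= a / 4, then damp_tilde is exactly the factor for which the
    product with s is a / 4, and a smaller factor moves y further towards
    P^-1 s, for which the product is a.  Otherwise both s . y and a exceed
    a / 4, and so does their convex combination. *)
Lemma damped_y_curvature_scalar : a / 4 <= dotv s (damped_y Lt P s y).
Proof.
rewrite /damped_y -/theta dotvDr !dotvZr dotv_invmx_scalar.
have t0 := damp_ge0; have t1 := damp_le1; have a0 := a_gt0.
have : theta <= damp_tilde P s y by rewrite ge_min lexx.
rewrite /damp_tilde dotv_invmx_scalar; case: ifPn => [sya|].
  have D0 : 0 < a - dotv s y by lra.
  by rewrite ler_pdivlMr//; lra.
rewrite -ltNge => sya _.
have : 0 <= theta * (dotv s y - 1 / 4 * a) by rewrite mulr_ge0//; lra.
have : 0 <= (1 - theta) * a by rewrite mulr_ge0//; lra.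
lra.
Qed.

Lemma damped_y_curvature (b : R) : c <= b ->
  dotv s s <= 4 * b * dotv s (damped_y Lt P s y).
Proof.
move=> cb; have := damped_y_curvature_scalar.
set q := dotv s _ => aq; have a0 := a_gt0.
have -> : dotv s s = c * a by rewrite /a mulrC divfK// gt_eqF.
apply: (@le_trans _ _ (c * (4 * q))); first by rewrite ler_pM2l//; lra.
by rewrite [leLHS]mulrCA -[leRHS]mulrA ler_pM2l// ler_wpM2r//; lra.
Qed.

Lemma damped_y_gt0 : 0 < dotv s (damped_y Lt P s y).
Proof. by apply: lt_le_trans damped_y_curvature_scalar; rewrite divr_gt0. Qed.

(** The cap in [damp] gives theta |y| <= Lt |s|; the other summand is at most
    |P^-1 s| = |s| / c because theta lies in [0, 1]. *)
Lemma enorm_damped_y (b : R) : 0 < b -> b <= c ->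
  enorm (damped_y Lt P s y) <= (Lt + b^-1) * enorm s.
Proof.
move=> b0 bc; rewrite /damped_y -/theta invmx_scalar_mul.
have t0 := damp_ge0; have t1 := damp_le1.
rewrite (le_trans (enormD _ _))// !enormZ ger0_norm// mulrDl lerD//.
  by rewrite -ler_pdivlMr ?enorm_gt0// ge_min lexx orbT.
rewrite mulrA ler_wpM2r ?enorm_ge0// ger0_norm; last by lra.
rewrite gtr0_norm ?invr_gt0// (@le_trans _ _ c^-1)//; last by rewrite lef_pV2.
by rewrite ler_piMl ?invr_ge0 ?(ltW c_gt0)//; lra.
Qed.

End Damping.

(** * Iterating the update *)

Lemma init_mx_scalar (R : realType) (d : nat) (beta B : R) (s y : 'cV[R]_d) :
  beta <= B -> exists2 h, beta <= h <= B & init_mx beta B s y = h%:M.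
Proof.
move=> bB; eexists; last reflexivity.
by rewrite le_min bB le_max lexx orbT ge_min lexx orbT.
Qed.

Section Iteration.

Variables (R : realType) (d M : nat) (eps Lt beta B : R).
Hypotheses (eps_gt0 : 0 < eps) (Lt_gt0 : 0 < Lt) (beta_gt0 : 0 < beta).
Hypothesis beta_le_B : beta <= B.
Variables (x g : nat -> 'cV[R]_d).
Hypotheses (s_neq0 : forall k, incr x k != 0) (y_neq0 : forall k, incr g k != 0).

Let omega := 4 * (B + eps) * (Lt + 1 / (beta + eps)).
Let C := omega ^+ 2 / (4 * (B + eps)).
Let D := 1 / (Lt * (omega + 2)).

Let Be_gt0 : 0 < B + eps.
Proof. by rewrite addr_gt0// (lt_le_trans beta_gt0). Qed.

Let be_gt0 : 0 < beta + eps.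
Proof. by rewrite addr_gt0. Qed.

Let omega_gt0 : 0 < omega.
Proof. by rewrite !mulr_gt0// addr_gt0// divr_gt0. Qed.

Let C_gt0 : 0 < C.
Proof. by apply: divr_gt0; [exact: exprn_gt0 | exact: mulr_gt0]. Qed.

Let D_gt0 : 0 < D.
Proof. by rewrite divr_gt0// mulr_gt0// addr_gt0. Qed.

(** The factor omega (omega + 2) is (1 + omega)^2 - 1: this says that
    (1 + omega)^2 h + 4 (B + eps) + D <= (1 + omega)^2 (h + D).  It holds
    because 4 (B + eps) / omega = 1 / (Lt + 1 / (beta + eps)) <= 1 / Lt. *)
Lemma shift_absorbs : 4 * (B + eps) <= omega * (omega + 2) * D.
Proof.
have -> : omega * (omega + 2) * D = omega / Lt.
  by rewrite /D; field; rewrite !gt_eqF// addr_gt0.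
rewrite ler_pdivlMr// /omega ler_pM2l ?mulr_gt0// lerDl.
by rewrite divr_ge0// ltW.
Qed.

(** Damping always refers to the initial matrix of time k, whereas the pair has
    its own index p.  The bounds depend on neither index because H^(0) + eps I is
    a multiple of the identity lying between (beta + eps) I and (B + eps) I. *)
Lemma damped_pair_bounds (k p : nat)
    (s := incr x p)
    (y := damped_y Lt (init_mx beta B (incr x k) (incr g k) + eps%:M)
            s (incr g p)) :
  [/\ 0 < dotv s y, dotv s s <= 4 * (B + eps) * dotv s y,
      enorm s * enorm y <= omega * dotv s y & dotv y y <= C * dotv s y].
Proof.
have [h /andP[bh hB] Eh] := init_mx_scalar (incr x k) (incr g k) beta_le_B.
rewrite /y Eh -raddfD /=; set c := h + eps; set yh := damped_y _ _ _ _.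
have c0 : 0 < c by rewrite addr_gt0// (lt_le_trans beta_gt0).
have cB : c <= B + eps by rewrite lerD2r.
have bc : beta + eps <= c by rewrite lerD2r.
have s0 : s != 0 := s_neq0 p.
have sy0 : 0 < dotv s yh by apply: damped_y_gt0.
have ss : dotv s s <= 4 * (B + eps) * dotv s yh.
  exact: damped_y_curvature.
have ny : enorm yh <= (Lt + 1 / (beta + eps)) * enorm s.
  by rewrite div1r; apply: enorm_damped_y.
set K := Lt + _ in ny.
have K0 : 0 < K by rewrite addr_gt0 ?divr_gt0.
split=> //.
  apply: (@le_trans _ _ (K * dotv s s)).
    by rewrite -sqr_enorm expr2 mulrCA ler_wpM2l ?enorm_ge0.
  by rewrite /omega -/K [leRHS]mulrAC [leRHS]mulrC ler_pM2l.
apply: (@le_trans _ _ (K ^+ 2 * dotv s s)).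
  rewrite -!sqr_enorm -exprMn ler_pXn2r ?nnegrE ?mulr_ge0 ?enorm_ge0//.
  exact: ltW.
(* C = 4 (B + eps) K^2 because omega = 4 (B + eps) K. *)
have -> : C * dotv s yh = K ^+ 2 * (4 * (B + eps) * dotv s yh).
  by rewrite /C /omega -/K; field; rewrite gt_eqF.
by rewrite ler_pM2l ?exprn_gt0.
Qed.

(** The reciprocal of the lower bound is arithmetic in t, and the upper bound
    shifted by D is geometric in t; these are the forms that one update
    preserves. *)
Lemma dlbfgs_iter_bounds (k t : nat)
    (Ht := dlbfgs_iter M eps Lt beta B x g k t) :
  [/\ Ht^T = Ht,
      forall v, (beta^-1 + t%:R * C)^-1 * dotv v v <= dotv v (Ht *m v)
    & forall v, dotv v (Ht *m v)
        <= ((1 + omega) ^+ (2 * t)%N * (B + D) - D) * dotv v v].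
Proof.
rewrite {}/Ht; elim: t => [|t [Hs Hlo Hup]].
  have [h /andP[bh hB] Eh] := init_mx_scalar (incr x k) (incr g k) beta_le_B.
  rewrite /= Eh tr_scalar_mx; split=> // v; rewrite mul_scalar_mx dotvZr.
    by rewrite mul0r addr0 invrK ler_wpM2r ?dotv_ge0.
  by rewrite muln0 expr0 mul1r addrK ler_wpM2r ?dotv_ge0.
have [sy0 ss nsy yy] := damped_pair_bounds k (k.+1 - minn k.+1 M + t).
set m := _^-1 in Hlo; set h := _ - D in Hup.
have m0 : 0 < m.
  by rewrite invr_gt0 ltr_wpDr ?invr_gt0// mulr_ge0 ?ler0n ?ltW.
have B0 : 0 < B by apply: lt_le_trans beta_le_B.
have h0 : 0 <= h.
  have p1 : 1 <= (1 + omega) ^+ (2 * t).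
    by rewrite exprn_ege1// lerDl ltW.
  rewrite subr_ge0 (le_trans (_ : D <= B + D))//; first by rewrite lerDr ltW.
  by rewrite ler_peMl// ltW// addr_gt0.
split=> [|v|v] /=; first exact: tr_bfgs_update.
  have -> : beta^-1 + t.+1%:R * C = m^-1 + C.
    by rewrite invrK -addn1 natrD mulrDl mul1r addrA.
  exact: bfgs_update_lower.
apply: le_trans (bfgs_update_upper sy0 h0 ss nsy Hup v) _.
rewrite ler_wpM2r ?dotv_ge0// /h mulnS exprD.
by have := shift_absorbs; lra.
Qed.

End Iteration.

Theorem theorem2 (R : realType) (n d M : nat)
    (n_ge1 : (1 <= n)%N) (d_ge1 : (1 <= d)%N) (M_ge1 : (1 <= M)%N)
    (eps Lt beta B : R)
    (eps_gt0 : 0 < eps) (Lt_gt0 : 0 < Lt)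
    (beta_gt0 : 0 < beta) (beta_le_B : beta <= B)
    (x g : 'I_n -> nat -> 'cV[R]_d)
    (s_neq0 : forall (i : 'I_n) (k : nat), incr (x i) k != 0)
    (y_neq0 : forall (i : 'I_n) (k : nat), incr (g i) k != 0)
    (H : 'I_n -> nat -> 'M[R]_d)
    (H_def : forall (i : 'I_n) (k : nat),
       H i k.+1 = dlbfgs_next M eps Lt beta B (x i) (g i) k) :
  let omega := 4 * (B + eps) * (Lt + 1 / (beta + eps)) in
  let M1 := (1 / beta + M%:R * omega ^+ 2 / (4 * (B + eps)))^-1 in
  let M2 := (1 + omega) ^+ (2 * M)%N * (B + 1 / (Lt * (omega + 2))) in
  forall (i : 'I_n) (k : nat), (1 <= k)%N ->
    loewner_le (M1%:M) (H i k) /\ loewner_le (H i k) (M2%:M).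
Proof.
move=> omega M1 M2 i [//|k] _; rewrite H_def /dlbfgs_next.
have [Hs Hlo Hup] := dlbfgs_iter_bounds M eps_gt0 Lt_gt0 beta_gt0 beta_le_B
  (s_neq0 i) (y_neq0 i) k (minn k.+1 M).
have tM : (minn k.+1 M <= M)%N := geq_minr _ _.
set t := minn _ _ in tM Hs Hlo Hup *.
have Be0 : 0 < B + eps by rewrite addr_gt0// (lt_le_trans beta_gt0).
have omega0 : 0 < omega.
  by rewrite !mulr_gt0// addr_gt0// divr_gt0// addr_gt0.
have D0 : 0 < 1 / (Lt * (omega + 2)) by rewrite divr_gt0// mulr_gt0// addr_gt0.
have B0 : 0 < B by apply: lt_le_trans beta_le_B.
split; [apply: loewner_scalar_lower|apply: loewner_scalar_upper] => // v.
  apply: le_trans (Hlo v); rewrite ler_wpM2r ?dotv_ge0// /M1 div1r -mulrA.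
  have C0 : 0 <= omega ^+ 2 / (4 * (B + eps)).
    by rewrite divr_ge0 ?sqr_ge0// mulr_ge0// ltW.
  have pos j : 0 < beta^-1 + j%:R * (omega ^+ 2 / (4 * (B + eps))).
    by rewrite ltr_wpDr ?invr_gt0// mulr_ge0.
  by rewrite lef_pV2 ?posrE ?pos// lerD2l ler_wpM2r// ler_nat.
apply: le_trans (Hup v) _; rewrite ler_wpM2r ?dotv_ge0//.
apply: (@le_trans _ _ ((1 + omega) ^+ (2 * t) * (B + 1 / (Lt * (omega + 2))))).
  by rewrite lerBlDr lerDl ltW.
apply: ler_wpM2r; first by rewrite ltW// addr_gt0.
by rewrite ler_weXn2l ?leq_mul2l ?tM ?orbT// lerDl ltW.
Qed.
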